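(* Let $H_0$ be a self-adjoint operator on a Hilbert space $\mathcal H$ with frame operator $F=\sum_j\kappa_j\langle\varphi_j,\cdot\rangle\psi_j:\mathcal H\to\mathcal K$. If $\lambda\in\Lambda(H_0;F)$, then the infinite matrix $$\phi(\lambda)=\big(\phi_{ij}(\lambda)\big)_{i,j=1}^\infty,\qquad \phi_{ij}(\lambda)=\frac1\pi\,\kappa_i\kappa_j\lim_{y\to0^+}\big\langle\varphi_i,\operatorname{Im}R_{\lambda+iy}(H_0)\varphi_j\big\rangle,$$ exists (all the limits exist) and, as an operator on $\ell_2$, it is non-negative and trace-class.
   Context: $\mathcal H,\mathcal K$ are complex separable Hilbert spaces with inner products linear in the second variable; $R_z(H)=(H-z)^{-1}$; $\operatorname{Im}T=(T-T^* )/2i$. Frame operator: a Hilbert–Schmidt operator $F=\sum_j\kappa_j\langle\varphi_j,\cdot\rangle\psi_j$, with $(\kappa_j)\in\ell_2$ a decreasing sequence of positive numbers and $(\varphi_j)$, $(\psi_j)$ orthonormal bases of $\mathcal H$, $\mathcal K$. $\Lambda(H_0;F)$ is the set of $\lambda\in\mathbb R$ such that, as $y\to0^+$, $FR_{\lambda+iy}(H_0)F^*$ converges in operator norm and $F\operatorname{Im}R_{\lambda+iy}(H_0)F^*$ converges in trace-class norm. *)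

(* Defs.v *)
From HB Require Import structures.
From mathcomp Require Import all_boot all_order all_algebra.
From mathcomp Require Import all_classical all_reals all_analysis.
From mathcomp Require Import complex.
From mathcomp Require Import ring lra.

Set Implicit Arguments.
Unset Strict Implicit.
Unset Printing Implicit Defensive.

Import Order.TTheory GRing.Theory Num.Theory.
Import numFieldNormedType.Exports.

Local Open Scope classical_set_scope.
Local Open Scope ring_scope.
Local Open Scope complex_scope.

Definition rnorm {R : realType} {V : normedZmodType R[i]} (x : V) : R :=
  complex.Re `|x|.

(* The norm takes its values in [R[i]]; positivity of the inner product is a
   consequence of [dotp_norm]. *)
HB.mixin Record isHilbert (R : realType) H & CompleteNormedModule R[i] H := {
  dotp : H -> H -> R[i];
  dotp_linear : forall (x : H) (a : R[i]) (y z : H),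
    dotp x (a *: y + z) = a * dotp x y + dotp x z;
  dotp_conj : forall x y : H, dotp x y = (dotp y x)^*;
  dotp_norm : forall x : H, `|x| ^+ 2 = dotp x x
}.

#[short(type="hilbertType")]
HB.structure Definition Hilbert (R : realType) :=
  {H of CompleteNormedModule R[i] H & isHilbert R H}.

Notation "⟪ x , y ⟫" := (dotp x y) (format "⟪ x ,  y ⟫") : ring_scope.

Section complex_topology.
Context {R : realType}.
Local Notation C := R[i]^o.
Implicit Types z : C.

Lemma rnormE {V : normedZmodType R[i]} (x : V) : (rnorm x)%:C = `|x|.
Proof. by rewrite /rnorm RRe_real// ger0_real. Qed.

Lemma rnorm_ge0 {V : normedZmodType R[i]} (x : V) : 0 <= rnorm x.
Proof. by rewrite -ler0c rnormE. Qed.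

Lemma ler_rnormD {V : normedZmodType R[i]} (x y : V) :
  rnorm (x + y) <= rnorm x + rnorm y.
Proof. by rewrite -lecR rmorphD/= !rnormE ler_normD. Qed.

Lemma rnorm_sqr (z : R[i]) :
  rnorm z ^+ 2 = complex.Re z ^+ 2 + complex.Im z ^+ 2.
Proof. by rewrite /rnorm normc_def/= sqr_sqrtr// addr_ge0// sqr_ge0. Qed.

Lemma ler_rnorm_Re (z : R[i]) : `|complex.Re z| <= rnorm z.
Proof.
rewrite -(@ler_pXn2r _ 2) ?nnegrE ?rnorm_ge0//.
by rewrite rnorm_sqr real_normK ?num_real// lerDl sqr_ge0.
Qed.

Lemma ler_rnorm_Im (z : R[i]) : `|complex.Im z| <= rnorm z.
Proof.
rewrite -(@ler_pXn2r _ 2) ?nnegrE ?rnorm_ge0//.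
by rewrite rnorm_sqr real_normK ?num_real// lerDr sqr_ge0.
Qed.

Lemma ler_rnorm_ReIm (z : R[i]) :
  rnorm z <= `|complex.Re z| + `|complex.Im z|.
Proof.
rewrite -(@ler_pXn2r _ 2) ?nnegrE ?rnorm_ge0 ?addr_ge0//.
rewrite rnorm_sqr -(real_normK (num_real (complex.Re z))).
rewrite -(real_normK (num_real (complex.Im z))).
have := normr_ge0 (complex.Re z); have := normr_ge0 (complex.Im z).
by set a := `|_|; set b := `|_| => *; nra.
Qed.

Lemma ReB (x y : R[i]) : complex.Re (x - y) = complex.Re x - complex.Re y.
Proof. by case: x y => [a b] [c d]. Qed.

Lemma ImB (x y : R[i]) : complex.Im (x - y) = complex.Im x - complex.Im y.
Proof. by case: x y => [a b] [c d]. Qed.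

Lemma cvg_rnormP {V : normedModType R[i]} {T} (F : set_system T) {FF : Filter F}
    (u : T -> V) (l : V) :
  u @ F --> l <-> forall e : R, 0 < e -> \forall t \near F, rnorm (l - u t) < e.
Proof.
split=> [/cvgrPdist_lt ul e e0|ul].
  have := ul e%:C; rewrite ltcR => /(_ e0); apply: filterS => t.
  by rewrite -rnormE ltcR.
apply/cvgrPdist_lt => e e0.
have /RRe_real eE : e \is Num.real by rewrite gtr0_real.
move: e0; rewrite -eE ltcR => /ul; apply: filterS => t.
by rewrite -rnormE ltcR.
Qed.

Lemma cvg_complexP {T} (F : set_system T) {FF : Filter F} (u : T -> C) (l : C) :
  u @ F --> l <->
  (complex.Re (u t) @[t --> F] --> complex.Re l) /\
  (complex.Im (u t) @[t --> F] --> complex.Im l).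
Proof.
split=> [/cvg_rnormP ul|[/cvgrPdist_lt re /cvgrPdist_lt im]].
  split; apply/cvgrPdist_lt => e /ul; apply: filterS => t.
    by rewrite -ReB; apply: le_lt_trans; exact: ler_rnorm_Re.
  by rewrite -ImB; apply: le_lt_trans; exact: ler_rnorm_Im.
apply/cvg_rnormP => e e0; have e20 : 0 < e / 2 by rewrite divr_gt0.
apply: filterS2 (re _ e20) (im _ e20) => t; rewrite -ReB -ImB => re2 im2.
apply: (le_lt_trans (ler_rnorm_ReIm _)).
by rewrite (splitr e) ltrD.
Qed.

Lemma complex_complete (F : set_system C) :
  ProperFilter F -> cauchy F -> cvg F.
Proof.
move=> FF /cauchyP Fc.
have cvF (f : C -> R) : (forall x y, `|f x - f y| <= rnorm (x - y)) ->
    cvg (f @ F).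
  move=> f1; apply: cauchy_cvg; apply/cauchyP => e e0.
  have := Fc e%:C; rewrite ltcR => /(_ e0)[x Fx]; exists (f x).
  rewrite /fmap/=; apply: filterS Fx => y; rewrite -!ball_normE/=.
  by rewrite -rnormE ltcR; exact: le_lt_trans.
have re := cvF (@complex.Re R) _; have im := cvF (@complex.Im R) _.
apply/cvg_ex; exists (Complex (lim (@complex.Re R @ F)) (lim (@complex.Im R @ F))).
apply/(@cvg_complexP _ F _ id); split.
  by apply: re => x y; rewrite -ReB ler_rnorm_Re.
by apply: im => x y; rewrite -ImB ler_rnorm_Im.
Qed.

End complex_topology.

Definition square_summable {R : realType} : {pred nat -> R[i]} :=
  mem [set a : nat -> R[i] | cvgn (series (fun n => rnorm (a n) ^+ 2))].

Section square_summable_closed.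
Context {R : realType}.
Implicit Types a b : nat -> R[i].

Lemma square_summableP a :
  reflect (cvgn (series (fun n => rnorm (a n) ^+ 2))) (a \in square_summable).
Proof. by rewrite /square_summable; apply: (iffP idP); rewrite inE. Qed.

Lemma rnormM (x y : R[i]) : rnorm (x * y) = rnorm x * rnorm y.
Proof. by apply: complexI; rewrite rmorphM/= !rnormE normrM. Qed.

Lemma square_summable_submod : submod_closed (@square_summable R).
Proof.
split=> [|k a b /square_summableP ca /square_summableP cb].
  apply/square_summableP; rewrite (_ : series _ = cst 0); first exact: is_cvg_cst.
  apply/funext => n; rewrite /series/= big1// => i _.
  by rewrite /rnorm normr0 expr0n.
apply/square_summableP.
apply: (@series_le_cvg R _
    (2 * rnorm k ^+ 2 *: (fun n => rnorm (a n) ^+ 2) +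
     2 *: (fun n => rnorm (b n) ^+ 2) : nat -> R)).
- by move=> n; exact: sqr_ge0.
- move=> n; rewrite !fctE /GRing.scale/=.
  by rewrite addr_ge0// mulr_ge0// ?sqr_ge0// mulr_ge0// sqr_ge0.
- move=> n; rewrite !fctE /GRing.scale/=.
  have /le_trans : rnorm (k * a n + b n) ^+ 2 <=
      (rnorm k * rnorm (a n) + rnorm (b n)) ^+ 2.
    by rewrite ler_pXn2r ?nnegrE ?addr_ge0 ?mulr_ge0 ?rnorm_ge0//
               -rnormM ler_rnormD.
  apply; rewrite -mulrA -exprMn; set x := _ * _; set y := rnorm _.
  by have := sqr_ge0 (x - y); nra.
- by apply: is_cvg_seriesD; exact: is_cvg_seriesZ.
Qed.

HB.instance Definition _ := GRing.isSubmodClosed.Build R[i] (nat -> R[i])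
  (@square_summable R) square_summable_submod.

End square_summable_closed.

Record ell2 (R : realType) :=
  Ell2 { ell2_fun :> nat -> R[i]; _ : ell2_fun \in square_summable }.

HB.instance Definition _ (R : realType) := [isSub for @ell2_fun R].
HB.instance Definition _ (R : realType) := [Choice of ell2 R by <:].
HB.instance Definition _ (R : realType) :=
  [SubChoice_isSubLmodule of ell2 R by <:].

Section ell2_norm.
Context {R : realType}.
Implicit Types a b : ell2 R.

Definition ell2_sqnorm a : R := limn (series (fun n => rnorm (a n) ^+ 2)).
Definition ell2_norm a : R := Num.sqrt (ell2_sqnorm a).

Lemma ell2P a : cvgn (series (fun n => rnorm (a n) ^+ 2)).
Proof. exact/square_summableP/valP. Qed.

Lemma ell2_nd a : nondecreasing_seq (series (fun n => rnorm (a n) ^+ 2)).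
Proof. by apply: nondecreasing_series => n _ _; exact: sqr_ge0. Qed.

Lemma ell2_sum_le a n :
  \sum_(0 <= k < n) rnorm (a k) ^+ 2 <= ell2_sqnorm a.
Proof. exact: (nondecreasing_cvgn_le (@ell2_nd a) (@ell2P a) n). Qed.

Lemma ell2_sqnorm_le a (M : R) :
  (forall n, \sum_(0 <= k < n) rnorm (a k) ^+ 2 <= M) -> ell2_sqnorm a <= M.
Proof.
by move=> aM; apply: limr_le; [exact: ell2P|near=> n; exact: aM].
Unshelve. all: by end_near. Qed.

Lemma ell2_sqnorm_ge0 a : 0 <= ell2_sqnorm a.
Proof. by rewrite (le_trans _ (@ell2_sum_le a 0))// big_nil. Qed.

Lemma ell2_norm_ge0 a : 0 <= ell2_norm a.
Proof. exact: sqrtr_ge0. Qed.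

Lemma ell2_norm_sqr a : ell2_norm a ^+ 2 = ell2_sqnorm a.
Proof. by rewrite sqr_sqrtr// ell2_sqnorm_ge0. Qed.

Lemma ell2_coord_le a n : rnorm (a n) <= ell2_norm a.
Proof.
rewrite -(@ler_pXn2r _ 2) ?nnegrE ?rnorm_ge0 ?ell2_norm_ge0// ell2_norm_sqr.
apply: le_trans (@ell2_sum_le a n.+1); rewrite big_nat_recr//= lerDr.
by rewrite sumr_ge0// => i _; exact: sqr_ge0.
Qed.

Lemma ell2_norm0_eq0 a : ell2_norm a = 0 -> a = 0.
Proof.
move=> a0; apply/val_inj/funext => n; have := @ell2_coord_le a n.
rewrite a0 => an0; have /eqP : rnorm (a n) = 0.
  by apply/eqP; rewrite eq_le an0 rnorm_ge0.
by rewrite -(inj_eq (@complexI R)) rnormE normr_eq0 => /eqP.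
Qed.

Lemma ell2_normZ (k : R[i]) a : ell2_norm (k *: a) = rnorm k * ell2_norm a.
Proof.
rewrite /ell2_norm -[X in X * _]ger0_norm ?rnorm_ge0// -sqrtr_sqr.
rewrite -sqrtrM ?sqr_ge0//; congr Num.sqrt.
rewrite /ell2_sqnorm -[RHS](lim_seriesZ _ (@ell2P a)).
congr (limn (series _)); apply/funext => n.
rewrite [RHS]/GRing.scale/= -[LHS]/(rnorm (k * a n) ^+ 2).
by rewrite rnormM exprMn.
Qed.

Lemma ell2_normD a b : ell2_norm (a + b) <= ell2_norm a + ell2_norm b.
Proof.
have [->|a0] := eqVneq a 0; first by rewrite add0r lerDr ell2_norm_ge0.
have [->|b0] := eqVneq b 0; first by rewrite addr0 lerDl ell2_norm_ge0.
have norm_gt0 (c : ell2 R) : c != 0 -> 0 < ell2_norm c.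
  move=> c0; rewrite lt_neqAle ell2_norm_ge0 andbT eq_sym.
  by apply: contra c0 => /eqP/ell2_norm0_eq0 ->.
have A0 := norm_gt0 _ a0; have B0 := norm_gt0 _ b0.
rewrite -(@ler_pXn2r _ 2) ?nnegrE ?addr_ge0 ?ell2_norm_ge0// ell2_norm_sqr.
apply: ell2_sqnorm_le => n; have := @ell2_sum_le a n; have := @ell2_sum_le b n.
rewrite -!ell2_norm_sqr; set A := ell2_norm a in A0 *; set B := ell2_norm b in B0 *.
set sb := \sum_(_ <= _ < _) _; set sa := \sum_(_ <= _ < _) _ => sbB saA.
have : \sum_(0 <= k < n) rnorm ((a + b) k) ^+ 2 <= (A + B) * (sa / A + sb / B).
  rewrite /sa /sb !mulr_suml -big_split/= mulr_sumr; apply: ler_sum => k _.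
  have /le_trans : rnorm ((a + b) k) ^+ 2 <= (rnorm (a k) + rnorm (b k)) ^+ 2.
    by rewrite ler_pXn2r ?nnegrE ?addr_ge0 ?rnorm_ge0// ler_rnormD.
  apply; set x := rnorm _; set y := rnorm _.
  rewrite -subr_ge0 (_ : _ - _ = (B * x - A * y) ^+ 2 / (A * B)).
    by rewrite divr_ge0 ?sqr_ge0// mulr_ge0// ltW.
  by field; rewrite !gt_eqF.
move=> /le_trans; apply; rewrite expr2 ler_pM2l ?addr_gt0//.
by rewrite lerD// ler_pdivrMr// -expr2.
Qed.

End ell2_norm.

Section ell2_normed.
Context {R : realType}.

Let normD (a b : ell2 R) :
  (ell2_norm (a + b))%:C <= (ell2_norm a)%:C + (ell2_norm b)%:C.
Proof. by rewrite -rmorphD/= lecR ell2_normD. Qed.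

Let normZ (k : R[i]) (a : ell2 R) :
  (ell2_norm (k *: a))%:C = `|k| * (ell2_norm a)%:C.
Proof. by rewrite ell2_normZ rmorphM/= rnormE. Qed.

Let norm_eq0 (a : ell2 R) : (ell2_norm a)%:C = 0 -> a = 0.
Proof. by move=> /complexI/ell2_norm0_eq0. Qed.

HB.instance Definition _ :=
  Lmodule_isNormed.Build R[i] (ell2 R) normD normZ norm_eq0.

End ell2_normed.

Section ell2_complete.
Context {R : realType}.

Lemma ell2_rnormE (a : ell2 R) : rnorm a = ell2_norm a. Proof. by []. Qed.

Lemma ell2_complete (F : set_system (ell2 R)) :
  ProperFilter F -> cauchy F -> cvg F.
Proof.
move=> FF /cauchyP Fc.
have Fsmall (e : R) : 0 < e -> exists2 x, F [set y | rnorm (x - y) < e] & True.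
  move=> e0; have := Fc e%:C; rewrite ltcR => /(_ e0)[x Fx]; exists x => //.
  apply: filterS Fx => y; rewrite -ball_normE/=.
  by rewrite -rnormE ltcR.
have coord n : cvg ((fun x : ell2 R => x n : R[i]^o) @ F).
  apply: complex_complete; apply/cauchyP => e e0.
  have /RRe_real eE : e \is Num.real by rewrite gtr0_real.
  move: e0; rewrite -eE ltcR => /Fsmall[x Fx _]; exists (x n).
  rewrite /fmap/=; apply: filterS Fx => y; rewrite -!ball_normE/=.
  rewrite -rnormE ltcR; apply: le_lt_trans.
  exact: (@ell2_coord_le _ (x - y) n).
pose l n : R[i]^o := lim ((fun x : ell2 R => x n : R[i]^o) @ F).
have sum_le (e : R) (x : ell2 R) : 0 < e -> F [set y | rnorm (x - y) < e] ->
    forall n, \sum_(0 <= k < n) rnorm (x k - l k) ^+ 2 <= e ^+ 2.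
  move=> e0 Fx n.
  have cv k : (fun y : ell2 R => rnorm (x k - y k) ^+ 2) @ F --> rnorm (x k - l k) ^+ 2.
    have /cvg_complexP[re im] := coord k.
    rewrite rnorm_sqr ReB ImB.
    under eq_fun do rewrite rnorm_sqr ReB ImB.
    by apply: cvgD; apply: cvgM; apply: cvgB => //; exact: cvg_cst.
  have cvs : (fun y : ell2 R => \sum_(0 <= k < n) rnorm (x k - y k) ^+ 2) @ F -->
      \sum_(0 <= k < n) rnorm (x k - l k) ^+ 2.
    elim: n => [|n IHn].
      rewrite big_nil; under eq_fun do rewrite big_nil; exact: cvg_cst.
    rewrite big_nat_recr//=; under eq_fun do rewrite big_nat_recr//=.
    exact: cvgD.
  rewrite -(cvg_lim _ cvs)//; apply: limr_le; first by apply/cvg_ex; eexists; exact: cvs.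
  apply: filterS Fx => y xy; have /le_trans := @ell2_sum_le _ (x - y) n; apply.
  rewrite -ell2_norm_sqr ler_pXn2r ?nnegrE ?ell2_norm_ge0 ?(ltW e0)//.
  exact: ltW.
have sq_sub (x : ell2 R) : (exists2 e : R, 0 < e & F [set y | rnorm (x - y) < e]) ->
    (fun n => x n - l n) \in @square_summable R.
  move=> [e e0 Fx]; apply/square_summableP; apply: nondecreasing_is_cvgn.
    by apply: nondecreasing_series => n _ _; exact: sqr_ge0.
  by exists (e ^+ 2) => _ [n _ <-]; exact: sum_le Fx n.
have [x1 Fx1 _] := Fsmall _ ltr01.
have l_sq : l \in @square_summable R.
  rewrite (_ : l = (x1 : nat -> R[i]) - (fun n => x1 n - l n)); last first.
    by apply/funext => n; rewrite !fctE subKr.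
  by rewrite rpredB ?(valP x1)//; apply: sq_sub; exists 1.
apply/cvg_ex; exists (Ell2 l_sq); apply/(@cvg_rnormP _ _ _ _ _ id) => e e0.
have e20 : 0 < e / 2 by rewrite divr_gt0.
have [x Fx _] := Fsmall _ e20.
have xl : rnorm (x - Ell2 l_sq) <= e / 2.
  rewrite ell2_rnormE -(@ler_pXn2r _ 2) ?nnegrE ?ell2_norm_ge0 ?(ltW e20)//.
  rewrite ell2_norm_sqr; apply: ell2_sqnorm_le => n.
  exact: (sum_le _ _ e20 Fx n).
apply: filterS Fx => y xy /=.
rewrite (_ : Ell2 l_sq - y = - (x - Ell2 l_sq) + (x - y)); last first.
  by rewrite opprB addrA subrK.
apply: (le_lt_trans (ler_rnormD _ _)); rewrite {1}/rnorm normrN (splitr e).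
exact: ler_ltD.
Qed.

HB.instance Definition _ := Uniform_isComplete.Build (ell2 R) ell2_complete.

Definition ell2_dotp (a b : ell2 R) : R[i] :=
  limn (series (fun n => (a n)^* * b n) : nat -> R[i]^o).

Lemma rnorm_conj (z : R[i]) : rnorm z^* = rnorm z.
Proof. by rewrite /rnorm !normc_def; case: z => x y /=; rewrite sqrrN. Qed.

Lemma ell2_dotp_cvg (a b : ell2 R) :
  cvgn (series (fun n => (a n)^* * b n) : nat -> R[i]^o).
Proof.
pose u n : R[i] := (a n)^* * b n.
have u_le n : rnorm (u n) <= rnorm (a n) ^+ 2 + rnorm (b n) ^+ 2.
  rewrite /u rnormM rnorm_conj.
  set x := rnorm _; set y := rnorm _.
  by have := sqr_ge0 (x - y); have := sqr_ge0 (x + y); nra.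
have part (f : R[i] -> R) : (forall z, `|f z| <= rnorm z) ->
    cvgn (series (fun n => f (u n))).
  move=> f_le; apply: normed_cvg.
  apply: (@series_le_cvg _ _
    ((fun n => rnorm (a n) ^+ 2) + (fun n => rnorm (b n) ^+ 2) : nat -> R)) => //.
  - by move=> n; exact: normr_ge0.
  - by move=> n; apply: addr_ge0; exact: sqr_ge0.
  - by move=> n; exact: le_trans (f_le _) (u_le n).
  - by apply: is_cvg_seriesD; exact: ell2P.
have re := part (@complex.Re R) (@ler_rnorm_Re R).
have im := part (@complex.Im R) (@ler_rnorm_Im R).
apply/cvg_ex; exists (Complex (limn (series (fun n => complex.Re (u n))))
                              (limn (series (fun n => complex.Im (u n))))).
apply/cvg_complexP; split.
- rewrite (_ : (fun _ => _) = series (fun n => complex.Re (u n)))//.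
  by apply/funext => n; rewrite /series/= (raddf_sum (@complex.Re R : Rcomplex R -> R)).
- rewrite (_ : (fun _ => _) = series (fun n => complex.Im (u n)))//.
  by apply/funext => n; rewrite /series/= (raddf_sum (@complex.Im R : Rcomplex R -> R)).
Qed.

Let ell2_dotp_linear (a : ell2 R) (k : R[i]) (b c : ell2 R) :
  ell2_dotp a (k *: b + c) = k * ell2_dotp a b + ell2_dotp a c.
Proof.
pose u b : nat -> R[i]^o := fun n => (a n)^* * b n.
rewrite /ell2_dotp -/(u b) -/(u c) -/(u (k *: b + c)).
have -> : u (k *: b + c) = k *: u b + u c.
  apply/funext => n.
  rewrite -[LHS]/((a n)^* * (k * b n + c n)).
  rewrite -[RHS]/(k * ((a n)^* * b n) + (a n)^* * c n); ring.
have ub : cvgn (series (u b)) := @ell2_dotp_cvg a b.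
have uc : cvgn (series (u c)) := @ell2_dotp_cvg a c.
by rewrite (lim_seriesD (is_cvg_seriesZ (k := k) ub) uc) (lim_seriesZ k ub).
Qed.

Let ell2_dotp_conj (a b : ell2 R) : ell2_dotp a b = (ell2_dotp b a)^*.
Proof.
have /cvg_complexP[re im] := @ell2_dotp_cvg b a.
apply: (@cvg_lim R[i]^o); first exact: norm_hausdorff.
apply/cvg_complexP.
have conj_sum n : series (fun n => (a n)^* * b n) n =
    (series (fun n => (b n)^* * a n) n)^*.
  rewrite /series/= rmorph_sum; apply: eq_bigr => k _.
  by rewrite rmorphM/= conjcK mulrC.
have ReJ (z : R[i]) : complex.Re z^* = complex.Re z by case: z.
have ImJ (z : R[i]) : complex.Im z^* = - complex.Im z by case: z.
rewrite ReJ ImJ; split; first by under eq_fun do rewrite conj_sum ReJ.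
by under eq_fun do rewrite conj_sum ImJ; exact: cvgN.
Qed.

Let ell2_dotp_norm (a : ell2 R) : `|a| ^+ 2 = ell2_dotp a a.
Proof.
rewrite -rnormE -rmorphXn/= ell2_rnormE ell2_norm_sqr; apply/esym.
apply: (@cvg_lim R[i]^o); first exact: norm_hausdorff.
have sumE n : series (fun n => (a n)^* * a n) n =
    (series (fun n => rnorm (a n) ^+ 2) n)%:C.
  rewrite /series/= rmorph_sum; apply: eq_bigr => k _.
  by rewrite rnorm_sqr; case: (a k) => x y; simpc; rewrite !expr2 [y * x]mulrC addrC subrr.
apply/cvg_complexP; split => /=; under eq_fun do rewrite sumE/=.
  exact: ell2P.
exact: cvg_cst.
Qed.

HB.instance Definition _ := isHilbert.Build R (ell2 R)
  ell2_dotp_linear ell2_dotp_conj ell2_dotp_norm.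

End ell2_complete.

Definition separable_space (T : topologicalType) :=
  exists D : set T, countable D /\ dense D.

Section bounded_operators.
Context {R : realType}.
Implicit Types H K : hilbertType R.

Definition opnorm H K (T : H -> K) : \bar R :=
  ereal_sup [set (rnorm (T x))%:E | x in [set x : H | rnorm x <= 1]].

Definition bounded_operator H K (T : H -> K) :=
  linear T /\ (opnorm T < +oo)%E.

Definition adjoint H K (T : H -> K) : K -> H := fun y =>
  xget 0 [set w | forall x, ⟪y, T x⟫ = ⟪w, x⟫].

Definition im_op H (T : H -> H) : H -> H := fun x =>
  (2 * 'i%C)^-1 *: (T x - adjoint T x).

(* The order of [R[i]]: [0 <= z] means that [z] is real and non-negative. *)
Definition nonneg_op H (T : H -> H) := forall x, 0 <= ⟪x, T x⟫.

Definition orthonormal_basis H (e : nat -> H) :=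
  (forall i j, ⟪e i, e j⟫ = (i == j)%:R) /\
  (forall x, \sum_(j < n) ⟪e j, x⟫ *: e j @[n --> \oo] --> x).

(* [P] is the absolute value |T|, i.e. the non-negative square root of T^*T. *)
Definition is_abs_op H K (T : H -> K) (P : H -> H) :=
  [/\ bounded_operator P, nonneg_op P & P \o P = adjoint T \o T].

Definition trace_on H (e : nat -> H) (P : H -> H) : \bar R :=
  (\sum_(0 <= j <oo) (complex.Re ⟪e j, P (e j)⟫)%:E)%E.

(* tr |T|. For a bounded [T] on an infinite-dimensional separable space the
   set below is a singleton, since |T| exists, is unique, and the trace of a
   non-negative operator does not depend on the orthonormal basis; the infimum
   only selects its element. *)
Definition trace_norm H K (T : H -> K) : \bar R :=
  ereal_inf [set t | exists e P,
    [/\ orthonormal_basis e, is_abs_op T P & t = trace_on e P]].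

Definition trace_class H K (T : H -> K) :=
  bounded_operator T /\ (trace_norm T < +oo)%E.

End bounded_operators.

Section self_adjoint_operators.
Context {R : realType}.

(* A possibly unbounded operator. The values of [op_fun] outside of [op_dom]
   are irrelevant. *)
Record partial_operator (H : hilbertType R) := PartialOperator {
  op_dom : set H;
  op_fun :> H -> H;
  op_dom0 : op_dom 0;
  op_domP : forall (a : R[i]) u v,
    op_dom u -> op_dom v -> op_dom (a *: u + v);
  op_linear : forall (a : R[i]) u v, op_dom u -> op_dom v ->
    op_fun (a *: u + v) = a *: op_fun u + op_fun v }.

Context {H : hilbertType R}.
Implicit Types A : partial_operator H.

Definition op_graph A : set (H * H) :=
  [set p | op_dom A p.1 /\ A p.1 = p.2].

Definition adjoint_graph A : set (H * H) :=
  [set p | forall u, op_dom A u -> ⟪p.1, A u⟫ = ⟪p.2, u⟫].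

Definition self_adjoint A :=
  dense (op_dom A) /\ adjoint_graph A = op_graph A.

(* (A - z)^{-1}, with the junk value 0 outside of the range of A - z (which is
   the whole space when A is self-adjoint and z is not real). *)
Definition resolvent A (z : R[i]) : H -> H := fun v =>
  xget 0 [set u | op_dom A u /\ A u - z *: u = v].

End self_adjoint_operators.

Section frame_operators.
Context {R : realType} {H K : hilbertType R}.

(* Basis vectors are indexed from 0, so that H and K are infinite-dimensional. *)
Record frame_operator (F : H -> K) (kappa : nat -> R)
    (phi : nat -> H) (psi : nat -> K) : Prop := FrameOperator {
  frame_gt0 : forall j, 0 < kappa j;
  frame_decreasing : nonincreasing_seq kappa;
  frame_ell2 : cvgn (series (fun j => kappa j ^+ 2));
  frame_basis_dom : orthonormal_basis phi;
  frame_basis_codom : orthonormal_basis psi;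
  frameE : forall x,
    \sum_(j < n) ((kappa j)%:C * ⟪phi j, x⟫) *: psi j @[n --> \oo] --> F x }.

Definition Lambda (H0 : partial_operator H) (F : H -> K) : set R := [set l |
  (exists2 B : K -> K, bounded_operator B &
     opnorm ((F \o resolvent H0 (l +i* y) \o adjoint F) \- B)
       @[y --> 0^'+] --> 0%E) /\
  (exists2 B : K -> K, trace_class B &
     trace_norm ((F \o im_op (resolvent H0 (l +i* y)) \o adjoint F) \- B)
       @[y --> 0^'+] --> 0%E)].

Definition im_resolvent_coef (H0 : partial_operator H) (phi : nat -> H)
    (l : R) (i j : nat) (y : R) : R[i]^o :=
  ⟪phi i, im_op (resolvent H0 (l +i* y)) (phi j)⟫.

Definition phi_matrix (H0 : partial_operator H) (kappa : nat -> R)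
    (phi : nat -> H) (l : R) (i j : nat) : R[i] :=
  (pi^-1 * kappa i * kappa j)%:C *
  lim (im_resolvent_coef H0 phi l i j y @[y --> 0^'+]).

End frame_operators.

Definition operator_of_matrix {R : realType} (m : nat -> nat -> R[i])
    (T : ell2 R -> ell2 R) :=
  forall (a : ell2 R) i,
    series (fun j => m i j * a j : R[i]^o) @ \oo --> (T a i : R[i]^o).

(* Main.v *)
(** Since [F^* psi_j = kappa_j phi_j], the matrix entry before the limit is
    [kappa_i kappa_j <phi_i, Im R phi_j> = <psi_i, F (Im R) F^* psi_j>]. An
    operator with an adjoint is bounded by its trace norm, so trace-norm
    convergence of [F (Im R) F^*] to [B] gives convergence of these entries to
    [<psi_i, B psi_j>], and [B >= 0] as a weak limit of non-negative operators.
    Hence the limit matrix is [pi^-1 B] read in the coordinates of the basis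
    [psi]. The coordinate map [K -> l2] is unitary, so it carries [|B|] and an
    orthonormal basis of [K] to the absolute value of the matrix operator and
    an orthonormal basis of [l2] with proportional trace; no square root has
    to be constructed. *)
Require Import Defs.
From mathcomp Require Import all_boot all_order all_algebra.
From mathcomp Require Import all_classical all_reals all_analysis.
From mathcomp Require Import complex.
From mathcomp Require Import ring lra.

Import Order.TTheory GRing.Theory Num.Theory.
Import numFieldNormedType.Exports.

Local Open Scope classical_set_scope.
Local Open Scope ring_scope.

Section trace_class_limit.
Local Open Scope complex_scope.
Set Implicit Arguments.
Unset Strict Implicit.
Unset Printing Implicit Defensive.

(** * Non-negative sesquilinear forms and the inner product *)

Section inner_product.
Context {R : realType}.

Lemma rnorm_real_ge0 (r : R) : 0 <= r -> rnorm (r%:C : R[i]) = r.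
Proof. by move=> r0; rewrite /rnorm ger0_norm ?ler0c. Qed.

Lemma rnormN (V : normedZmodType R[i]) (x : V) : rnorm (- x) = rnorm x.
Proof. by rewrite /rnorm normrN. Qed.

Lemma rnorm0 (V : normedZmodType R[i]) : rnorm (0 : V) = 0.
Proof. by rewrite /rnorm normr0. Qed.

Lemma mulr_conjc (z : R[i]) : z^*%C * z = (rnorm z ^+ 2)%:C.
Proof. by rewrite rnorm_sqr; case: z => a b; simpc; rewrite !expr2 [b * a]mulrC addrC subrr. Qed.

(* For a complex form, nonnegativity of the diagonal values already forces
   hermitian symmetry (polarization). *)
Lemma nonneg_form_conj (V : lmodType R[i]) (s : V -> V -> R[i])
    (sl : forall x a y z, s x (a *: y + z) = a * s x y + s x z)
    (sr : forall x a y z, s (a *: y + z) x = a^*%C * s y x + s z x)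
    (s_ge0 : forall x, 0 <= s x x) x y : s x y = (s y x)^*%C.
Proof.
have imE z : complex.Im (s z z) = 0 by have := s_ge0 z; rewrite lecE => /andP[/eqP].
have H1 : complex.Im (s x y + s y x) = 0.
  have := imE (1 *: x + y); rewrite sl !sr.
  have := imE x; have := imE y.
  move: (s x x) (s x y) (s y x) (s y y) => [a1 a2] [b1 b2] [c1 c2] [d1 d2]; simpc.
  rewrite /=; lra.
have H2 : complex.Re (s y x - s x y) = 0.
  have := imE ('i%C *: x + y); rewrite sl !sr.
  have := imE x; have := imE y.
  move: (s x x) (s x y) (s y x) (s y y) => [a1 a2] [b1 b2] [c1 c2] [d1 d2]; simpc.
  rewrite /=; lra.
move: H1 H2; move: (s x y) (s y x) => [b1 b2] [c1 c2]; simpc => /= *.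
by apply/eqP; rewrite eq_complex /=; apply/andP; split; apply/eqP; lra.
Qed.

(** Discriminant argument on [s] at [- t * s x y *: x + y] with [t] real. It is stated for
    degenerate forms so that it also covers [⟪u, P v⟫] with [P] a non-negative operator. *)
Lemma nonneg_form_CS (V : lmodType R[i]) (s : V -> V -> R[i])
    (sl : forall x a y z, s x (a *: y + z) = a * s x y + s x z)
    (sr : forall x a y z, s (a *: y + z) x = a^*%C * s y x + s z x)
    (s_ge0 : forall x, 0 <= s x x) x y :
  rnorm (s x y) ^+ 2 <= complex.Re (s x x) * complex.Re (s y y).
Proof.
have sc := nonneg_form_conj sl sr s_ge0.
have imE z : complex.Im (s z z) = 0 by have := s_ge0 z; rewrite lecE => /andP[/eqP].
have reE z : 0 <= complex.Re (s z z) by have := s_ge0 z; rewrite lecE => /andP[].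
have Q (t : R) : 0 <= t ^+ 2 * rnorm (s x y) ^+ 2 * complex.Re (s x x)
    - 2 * t * rnorm (s x y) ^+ 2 + complex.Re (s y y).
  have := reE ((- t%:C * s x y) *: x + y); rewrite sl !sr (sc y x) rnorm_sqr.
  have := imE x; have := imE y.
  move: (s x x) (s x y) (s y y) => [a1 a2] [b1 b2] [d1 d2]; simpc => /= _ ->.
  move=> h; apply: (le_trans h); rewrite le_eqVlt; apply/orP; left; apply/eqP; ring.
have a0 := reE x; have d0 := reE y.
move: Q a0 d0; set a := complex.Re (s x x); set d := complex.Re (s y y).
set b := rnorm _ ^+ 2 => Q a0 d0.
have b0 : 0 <= b by exact: sqr_ge0.
have [a_eq|an0] := eqVneq a 0.
  rewrite a_eq mul0r leNgt; apply/negP => b_gt0.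
  (* With [a = 0] the quadratic is affine in [t]; this [t] gives it the value -1. *)
  have := Q ((d + 1) / (2 * b)); rewrite a_eq mulr0 add0r.
  rewrite (_ : 2 * ((d + 1) / (2 * b)) * b = d + 1); last by field; rewrite gt_eqF.
  lra.
have a_gt0 : 0 < a by rewrite lt_neqAle eq_sym an0.
(* The minimiser of the quadratic, where its value is [d - b / a]. *)
have := Q a^-1.
rewrite (_ : _ + d = (a * d - b) / a); last by field.
by rewrite pmulr_lge0 ?invr_gt0// subr_ge0.
Qed.

Context (H : hilbertType R).
Implicit Types x y z w : H.

Lemma dotpZDr x a y z : ⟪x, a *: y + z⟫ = a * ⟪x, y⟫ + ⟪x, z⟫.
Proof. exact: dotp_linear. Qed.

Lemma dotpZDl x a y z : ⟪a *: y + z, x⟫ = a^*%C * ⟪y, x⟫ + ⟪z, x⟫.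
Proof. by rewrite dotp_conj dotpZDr rmorphD rmorphM /= -!dotp_conj. Qed.

Lemma dotpDr x y z : ⟪x, y + z⟫ = ⟪x, y⟫ + ⟪x, z⟫.
Proof. by have := dotpZDr x 1 y z; rewrite scale1r mul1r. Qed.

Lemma dotp0r x : ⟪x, 0⟫ = 0.
Proof. by apply: (addrI ⟪x, 0⟫); rewrite -dotpDr !addr0. Qed.

Lemma dotpZr x a y : ⟪x, a *: y⟫ = a * ⟪x, y⟫.
Proof. by rewrite -[a *: y]addr0 dotpZDr dotp0r addr0. Qed.

Lemma dotpNr x y : ⟪x, - y⟫ = - ⟪x, y⟫.
Proof. by rewrite -scaleN1r dotpZr mulN1r. Qed.

Lemma dotpBr x y z : ⟪x, y - z⟫ = ⟪x, y⟫ - ⟪x, z⟫.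
Proof. by rewrite dotpDr dotpNr. Qed.

Lemma dotpDl x y z : ⟪y + z, x⟫ = ⟪y, x⟫ + ⟪z, x⟫.
Proof. by rewrite dotp_conj dotpDr rmorphD /= -!dotp_conj. Qed.

Lemma dotpZl x a y : ⟪a *: y, x⟫ = a^*%C * ⟪y, x⟫.
Proof. by rewrite dotp_conj dotpZr rmorphM /= -dotp_conj. Qed.

Lemma dotpNl x y : ⟪- y, x⟫ = - ⟪y, x⟫.
Proof. by rewrite dotp_conj dotpNr rmorphN /= -dotp_conj. Qed.

Lemma dotpBl x y z : ⟪y - z, x⟫ = ⟪y, x⟫ - ⟪z, x⟫.
Proof. by rewrite dotpDl dotpNl. Qed.

Lemma dotp_sumr x n (f : 'I_n -> H) : ⟪x, \sum_(j < n) f j⟫ = \sum_(j < n) ⟪x, f j⟫.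
Proof.
by elim/big_rec2: _ => [|j y z _ <-]; rewrite ?dotp0r ?dotpDr.
Qed.

Lemma dotpxx x : ⟪x, x⟫ = (rnorm x ^+ 2)%:C.
Proof. by rewrite -dotp_norm -rnormE rmorphXn. Qed.

Lemma dotp_ge0 x : 0 <= ⟪x, x⟫.
Proof. by rewrite dotpxx ler0c sqr_ge0. Qed.

Lemma Re_dotpxx x : complex.Re ⟪x, x⟫ = rnorm x ^+ 2.
Proof. by rewrite dotpxx. Qed.

Lemma rnorm_eq0 x : rnorm x = 0 -> x = 0.
Proof. by move=> h; apply/eqP; rewrite -normr_eq0 -rnormE h. Qed.

Lemma rnormZ a x : rnorm (a *: x) = rnorm a * rnorm x.
Proof. by apply: complexI; rewrite rmorphM /= !rnormE normrZ. Qed.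

Lemma rnormB x y : rnorm (x - y) = rnorm (y - x).
Proof. by rewrite /rnorm distrC. Qed.

Lemma CauchySchwarz x y : rnorm ⟪x, y⟫ <= rnorm x * rnorm y.
Proof.
rewrite -(@ler_pXn2r _ 2) ?nnegrE ?mulr_ge0 ?rnorm_ge0// exprMn -!Re_dotpxx.
apply: (@nonneg_form_CS H (@dotp R H)); [exact: dotpZDr|exact: dotpZDl|exact: dotp_ge0].
Qed.

Lemma dotp_inj x y : (forall z, ⟪x, z⟫ = ⟪y, z⟫) -> x = y.
Proof.
move=> xy; apply/eqP; rewrite -subr_eq0; apply/eqP/rnorm_eq0/eqP.
by rewrite -sqrf_eq0 -Re_dotpxx dotpBl xy subrr.
Qed.

Lemma dotp_cvg T (G : set_system T) {FG : Filter G} w (u : T -> H) x :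
  u @ G --> x -> (⟪w, u t⟫ : R[i]^o) @[t --> G] --> (⟪w, x⟫ : R[i]^o).
Proof.
move=> /cvg_rnormP ux; apply/cvg_rnormP => e e0.
have e1 : 0 < e / (rnorm w + 1) by rewrite divr_gt0// ltr_wpDl// rnorm_ge0.
have w1 : 0 < rnorm w + 1 by rewrite ltr_wpDl// rnorm_ge0.
apply: filterS (ux _ e1) => t; rewrite ltr_pdivlMr// => h.
rewrite -dotpBr; apply: (le_lt_trans (CauchySchwarz _ _)).
apply: le_lt_trans h; rewrite mulrC ler_wpM2l ?rnorm_ge0//; lra.
Qed.

End inner_product.

(** * Riesz representation by minimisation *)

Section riesz.
Context {R : realType}.
Context (H : hilbertType R).
Implicit Types x y z w : H.

Lemma ReD (x y : R[i]) : complex.Re (x + y) = complex.Re x + complex.Re y.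
Proof. by case: x y => [a b] [c d]. Qed.

Lemma ReMr (r : R) (x : R[i]) : complex.Re (r%:C * x) = r * complex.Re x.
Proof. by case: x => a b; simpc. Qed.

Lemma Re_conjc (x : R[i]) : complex.Re x^*%C = complex.Re x.
Proof. by case: x. Qed.

Lemma Re_dotpC x y : complex.Re ⟪x, y⟫ = complex.Re ⟪y, x⟫.
Proof. by rewrite dotp_conj Re_conjc. Qed.

Lemma rnormD_sqr x y :
  rnorm (x + y) ^+ 2 = rnorm x ^+ 2 + 2 * complex.Re ⟪x, y⟫ + rnorm y ^+ 2.
Proof.
rewrite -!Re_dotpxx dotpDr !dotpDl !ReD (Re_dotpC y x); ring.
Qed.

Lemma rnormB_sqr x y :
  rnorm (x - y) ^+ 2 = rnorm x ^+ 2 - 2 * complex.Re ⟪x, y⟫ + rnorm y ^+ 2.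
Proof.
rewrite -!Re_dotpxx dotpBr !dotpBl !ReB (Re_dotpC y x); ring.
Qed.

Lemma hilbert_cauchy_cvg (u : nat -> H) :
  (forall e : R, 0 < e -> exists N, forall n, (N <= n)%N -> rnorm (u N - u n) < e) ->
  cvgn u.
Proof.
move=> uC; apply: cauchy_cvg; apply/cauchyP => e e0.
have /RRe_real eE : e \is Num.real by rewrite gtr0_real.
move: e0; rewrite -eE ltcR => /uC[N uN]; exists (u N).
exists N => // n /= /uN; rewrite -ball_normE /=.
by rewrite -rnormE ltcR.
Qed.

(* [u] is the limit of a minimising sequence of
   [|j x|^2 - 2 Re (g x)], so the range of [j] need not be closed or dense;
   for this reason the same lemma solves the resolvent equation. *)
Lemma riesz_along (V : lmodType R[i]) (D : set V) (j : V -> H) (g : V -> R[i]) (M : R) :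
  D 0 ->
  (forall a (x y : V), D x -> D y -> D (a *: x + y)) ->
  (forall a (x y : V), D x -> D y -> j (a *: x + y) = a *: j x + j y) ->
  (forall a (x y : V), D x -> D y -> g (a *: x + y) = a * g x + g y) ->
  (forall x : V, D x -> rnorm (g x) <= M * rnorm (j x)) ->
  exists u, forall x : V, D x -> ⟪u, j x⟫ = g x.
Proof.
move=> D0 DD jD gD gM.
pose J (x : V) := rnorm (j x) ^+ 2 - 2 * complex.Re (g x).
(* Completing the square in [rnorm (j x) - M] bounds [J] below, so its infimum exists. *)
have J_ge (x : V) : D x -> - M ^+ 2 <= J x.
  move=> /gM h; have := ler_rnorm_Re (g x); rewrite ler_norml => /andP[_ h2].
  have := sqr_ge0 (rnorm (j x) - M); rewrite /J; nra.
have S_inf : has_inf (J @` D).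
  by split; [exists (J 0), 0|exists (- M ^+ 2) => _ [x Dx <-]; exact: J_ge].
set d := inf (J @` D).
have J_d (x : V) : D x -> d <= J x.
  by move=> Dx; apply: ge_inf; [case: S_inf|exists x].
have /choice[s sP] : forall n, exists x : V, D x /\ J x < d + harmonic n.
  move=> n; have e0 : 0 < harmonic n :> R by rewrite invr_gt0.
  by have [_ [x Dx <-] h] := inf_adherent e0 S_inf; exists x.
have sD n : D (s n) by case: (sP n).
have sJ n : J (s n) < d + harmonic n by case: (sP n).
(* Parallelogram law, with [d <= J] at the midpoint of [x] and [y]. The term [+ 0] puts the midpoint
   in the shape [a *: x + y] of the linearity hypotheses. *)
have half (x y : V) : D x -> D y -> rnorm (j x - j y) ^+ 2 <= 2 * (J x + J y - 2 * d).
  move=> Dx Dy.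
  have Dz : D (2^-1%:C *: x + (2^-1%:C *: y + 0)) by apply/DD/DD.
  have Dz' : D (2^-1%:C *: y + 0) by exact: DD.
  have j0 : j 0 = 0 by have := jD (-1) 0 0 D0 D0; rewrite scaler0 addr0 scaleN1r addNr.
  have g0 : g 0 = 0 by have := gD (-1) 0 0 D0 D0; rewrite scaler0 addr0 mulN1r addNr.
  have := J_d _ Dz; rewrite /J jD// jD// j0 addr0 gD// gD// g0 addr0 rnormB_sqr.
  rewrite rnormD_sqr !rnormZ rnorm_real_ge0 ?invr_ge0// dotpZl dotpZr ReD conjc_real !ReMr.
  lra.
have cv : cvgn (fun n => j (s n)).
  apply: hilbert_cauchy_cvg => e e0.
  (* Two values of [J] within [e ^+ 2 / 4] of [d] make the bound of [half] smaller than [e ^+ 2]. *)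
  have e4 : 0 < e ^+ 2 / 4 by rewrite divr_gt0// exprn_gt0.
  have [N _ NP] := near_infty_natSinv_lt (PosNum e4).
  exists N => n Nn; rewrite -(@ltr_pXn2r _ 2) ?nnegrE ?rnorm_ge0 ?(ltW e0)//.
  apply: (le_lt_trans (half _ _ (sD N) (sD n))).
  have JN k : (N <= k)%N -> J (s k) < d + e ^+ 2 / 4.
    by move=> Nk; apply: lt_trans (sJ k) _; rewrite ltrD2l; exact: NP.
  have := JN N (leqnn N); have := JN n Nn; lra.
pose u := limn (fun n => j (s n)); exists u => x Dx.
pose c := ⟪u, j x⟫ - g x; pose q := rnorm (j x) ^+ 2.
(* First variation: [d <= J (t *: x + s n)] and [J (s n) < d + harmonic n] are combined, then [n]
   tends to infinity. *)
have Q t : 0 <= 2 * complex.Re (t * c) + rnorm t ^+ 2 * q.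
  pose v n : R := harmonic n + 2 * (complex.Re ⟪t *: j x, j (s n)⟫ - complex.Re (t * g x))
    + rnorm t ^+ 2 * q.
  have v0 n : 0 <= v n.
    have := J_d _ (DD t x (s n) Dx (sD n)); have := sJ n.
    rewrite /J jD// gD// rnormD_sqr rnormZ exprMn ReD /v -/q; lra.
  have vc : v n @[n --> \oo] --> 0 + 2 * (complex.Re ⟪t *: j x, u⟫ - complex.Re (t * g x))
    + rnorm t ^+ 2 * q.
    apply: cvgD; last exact: cvg_cst.
    apply: cvgD; first exact: cvg_harmonic.
    apply: cvgM; first exact: cvg_cst.
    apply: cvgB; last exact: cvg_cst.
    exact: (proj1 ((cvg_complexP _ _).1 (@dotp_cvg R H _ _ _ (t *: j x) _ _ cv))).

  have : 0 <= 0 + 2 * (complex.Re ⟪t *: j x, u⟫ - complex.Re (t * g x)) + rnorm t ^+ 2 * q.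
    rewrite -(cvg_lim _ vc)//; apply: limr_ge; first by apply/cvg_ex; eexists; exact: vc.
    by apply: nearW => n; exact: v0.
  by rewrite add0r Re_dotpC dotpZr -ReB -mulrBr.
have q0 : 0 <= q by exact: sqr_ge0.
have b0 : 0 <= rnorm c ^+ 2 by exact: sqr_ge0.
(* This [t] turns the bound into a negative multiple of [rnorm c ^+ 2], which forces [c = 0];
   [q + 1] avoids dividing by zero when [j x = 0]. *)
have := Q (- ((q + 1)^-1%:C * c^*%C)).
rewrite mulNr -mulrA mulr_conjc (_ : rnorm (- _) ^+ 2 = (q + 1)^-2 * rnorm c ^+ 2); last first.
  by rewrite rnormN rnormM rnorm_conj rnorm_real_ge0 ?invr_ge0 ?exprMn ?exprVn//; lra.
rewrite -rmorphM /= (_ : _ + _ = - (rnorm c ^+ 2 * ((q + 2) / (q + 1) ^+ 2))); last by field; lra.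
rewrite oppr_ge0 pmulr_lle0; last by rewrite divr_gt0 ?exprn_gt0//; lra.
move=> c0; have : rnorm c ^+ 2 == 0 by rewrite eq_le c0 b0.
rewrite sqrf_eq0 => /eqP h; apply/eqP; rewrite -subr_eq0 -normr_eq0 -rnormE.
by rewrite -/c h.
Qed.

Lemma riesz (g : H -> R[i]) (M : R) :
  (forall a x y, g (a *: x + y) = a * g x + g y) ->
  (forall x, rnorm (g x) <= M * rnorm x) -> exists u, forall x, ⟪u, x⟫ = g x.
Proof.
move=> gD gM.
have [u uP] : exists u, forall x, setT x -> ⟪u, id x⟫ = g x.
  by apply: (@riesz_along H setT id g M) => // x _; exact: gM.
by exists u => x; exact: uP.
Qed.

End riesz.

(** * Orthonormal bases, bounded operators and adjoints *)

Section operators.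
Context {R : realType}.
Context (H K : hilbertType R).

Lemma cvg_complex_unique (T : Type) (G : set_system T) {FG : ProperFilter G}
    (f : T -> R[i]^o) (a b : R[i]^o) : f @ G --> a -> f @ G --> b -> a = b.
Proof. exact: (cvg_unique (@norm_hausdorff _ _)). Qed.

(** The inner product is continuous, and the [i]-th coordinate of the partial sums is constant once
    [n > i]. *)
Lemma orthonormal_coord (V : hilbertType R) (e : nat -> V) (c : nat -> R[i]) x i :
  (forall i j, ⟪e i, e j⟫ = (i == j)%:R) ->
  \sum_(j < n) c j *: e j @[n --> \oo] --> x -> ⟪e i, x⟫ = c i.
Proof.
move=> eo cx.
apply: (@cvg_complex_unique _ _ _ _ _ _ (@dotp_cvg R V _ _ _ (e i) _ _ cx)).
apply: cvg_near_cst; exists i.+1 => // n /= ni.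
rewrite dotp_sumr (bigD1 (Ordinal ni))//= dotpZr eo eqxx mulr1 big1 ?addr0// => j ji.
rewrite dotpZr eo (_ : (i == j) = false) ?mulr0//.
by apply/negbTE; apply: contra ji => /eqP ij; apply/eqP/val_inj.
Qed.

Section basis.
Context (V : hilbertType R) (e : nat -> V) (eB : orthonormal_basis e).

Lemma basis_inj x y : (forall i, ⟪e i, x⟫ = ⟪e i, y⟫) -> x = y.
Proof.
move=> xy; have := eB.2 x.
have -> : (fun n => \sum_(j < n) ⟪e j, x⟫ *: e j) = (fun n => \sum_(j < n) ⟪e j, y⟫ *: e j).
  by apply/funext => n; apply: eq_bigr => j _; rewrite xy.
by move=> yx; exact: (cvg_unique (@norm_hausdorff _ V) yx (eB.2 y)).
Qed.

Lemma parseval_dotp x y :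
  series (fun j => ⟪e j, x⟫^*%C * ⟪e j, y⟫ : R[i]^o) @ \oo --> (⟪x, y⟫ : R[i]^o).
Proof.
rewrite (_ : series _ = (fun n => ⟪x, \sum_(j < n) ⟪e j, y⟫ *: e j⟫)).
  exact: (@dotp_cvg R V _ _ _ x _ _ (eB.2 y)).
apply/funext => n; rewrite dotp_sumr /series /= big_mkord; apply: eq_bigr => j _.
by rewrite dotpZr mulrC -dotp_conj.
Qed.

Lemma parseval x :
  series (fun j => rnorm ⟪e j, x⟫ ^+ 2) @ \oo --> rnorm x ^+ 2.
Proof.
rewrite -Re_dotpxx (_ : series _ = (fun n => complex.Re
  (series (fun j => ⟪e j, x⟫^*%C * ⟪e j, x⟫ : R[i]^o) n))).
  by have /cvg_complexP[] := @parseval_dotp x x.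
apply/funext => n.
rewrite /series /= (raddf_sum (@complex.Re R : Rcomplex R -> R)).
by apply: eq_bigr => j _; rewrite mulr_conjc.
Qed.

Lemma parseval_le x (M : R) :
  (forall n, series (fun j => rnorm ⟪e j, x⟫ ^+ 2) n <= M) -> rnorm x ^+ 2 <= M.
Proof.
move=> xM; rewrite -(cvg_lim _ (@parseval x))//; apply: limr_le.
  by apply/cvg_ex; eexists; exact: parseval.
by apply: nearW.
Qed.

Lemma bessel x n : series (fun j => rnorm ⟪e j, x⟫ ^+ 2) n <= rnorm x ^+ 2.
Proof.
rewrite -(cvg_lim _ (@parseval x))//; apply: nondecreasing_cvgn_le.
  by apply: nondecreasing_series => k _ _; exact: sqr_ge0.
by apply/cvg_ex; eexists; exact: parseval.
Qed.

End basis.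

Implicit Types (T : H -> K).

Lemma linear_op0 T : linear T -> T 0 = 0.
Proof. by move=> /(_ (-1) 0 0); rewrite scaler0 addr0 scaleN1r addNr. Qed.

Lemma linear_opZ T : linear T -> forall a x, T (a *: x) = a *: T x.
Proof. by move=> Tl a x; rewrite -[a *: x]addr0 Tl linear_op0// addr0. Qed.

Lemma bounded_operator_le T : bounded_operator T ->
  exists2 M, 0 <= M & forall x, rnorm (T x) <= M * rnorm x.
Proof.
move=> [Tl Tb].
have T0 : (0 <= opnorm T)%E.
  apply: ereal_sup_ubound; exists 0 => /=; first by rewrite rnorm0 ler01.
  by rewrite linear_op0// rnorm0.
have Tfin : opnorm T \is a fin_num by rewrite ge0_fin_numE.
exists (fine (opnorm T)); first exact: fine_ge0.
move=> x; have [x0|x0] := eqVneq (rnorm x) 0.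
  by rewrite (rnorm_eq0 x0) linear_op0// !rnorm0 mulr0.
have x_gt0 : 0 < rnorm x by rewrite lt_neqAle eq_sym x0 rnorm_ge0.
rewrite -ler_pdivrMr// mulrC -[X in X * _](@rnorm_real_ge0 R) ?invr_ge0 ?rnorm_ge0//.
rewrite -rnormZ -linear_opZ// -lee_fin fineK//; apply: ereal_sup_ubound.
exists ((rnorm x)^-1%:C *: x) => //=.
by rewrite rnormZ rnorm_real_ge0 ?invr_ge0 ?rnorm_ge0// mulVf.
Qed.

Lemma bounded_operatorI T (M : R) : linear T ->
  (forall x, rnorm (T x) <= M * rnorm x) -> bounded_operator T.
Proof.
move=> Tl TM; split=> //; apply: (@le_lt_trans _ _ `|M|%:E); last exact: ltry.
apply: ge_ereal_sup => _ [x /= x1 <-]; rewrite lee_fin.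
apply: le_trans (TM x) _; apply: (@le_trans _ _ (`|M| * rnorm x)).
  by rewrite ler_wpM2r ?rnorm_ge0 ?ler_norm.
by rewrite ler_piMr.
Qed.

(** The inner product separates points, so [w] is the only element that [xget] can choose, and the
    default 0 is excluded. *)
Lemma adjoint_eq T y w : (forall x, ⟪y, T x⟫ = ⟪w, x⟫) -> adjoint T y = w.
Proof.
move=> yw; rewrite /adjoint; case: xgetP => [v -> /= vP|/(_ w)//].
by apply: dotp_inj => x; rewrite -vP yw.
Qed.

Lemma adjointE T (T' : K -> H) :
  (forall x y, ⟪y, T x⟫ = ⟪T' y, x⟫) -> adjoint T = T'.
Proof. by move=> TT; apply/funext => y; apply: adjoint_eq => x; exact: TT. Qed.

(** Riesz applied to the bounded functional [x ↦ ⟪y, T x⟫] makes the set behind [adjoint]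
    non-empty. *)
Lemma bounded_adjointP T : bounded_operator T ->
  forall x y, ⟪y, T x⟫ = ⟪adjoint T y, x⟫.
Proof.
move=> bT x y; have [M M0 TM] := bounded_operator_le bT.
have [u uP] : exists u, forall x, ⟪u, x⟫ = ⟪y, T x⟫.
  apply: (@riesz R H (fun x => ⟪y, T x⟫) (rnorm y * M)) => [a z w|z].
    by rewrite bT.1 dotpZDr.
  by rewrite -mulrA (le_trans (CauchySchwarz _ _))// ler_wpM2l ?rnorm_ge0.
by rewrite (@adjoint_eq _ _ u) ?uP.
Qed.

End operators.

(** * The trace norm dominates the operator norm *)

Section trace.
Context {R : realType}.
Context (H K : hilbertType R).
Implicit Types (T : H -> K) (P : H -> H).

Lemma nonneg_op_symmetric P : linear P -> nonneg_op P ->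
  forall x y, ⟪x, P y⟫ = ⟪P x, y⟫.
Proof.
move=> Pl P0 x y; rewrite [RHS]dotp_conj.
apply: (@nonneg_form_conj R H (fun u v => ⟪u, P v⟫)) => [u a v w|u a v w|//].
  by rewrite Pl dotpZDr.
by rewrite dotpZDl.
Qed.

(** Cauchy-Schwarz for the form [⟪u, P v⟫] at [e j] and [x], summed over [j] by Parseval, gives
    [|P x|^2 <= t ⟪x, P x⟫ <= t |x| |P x|]; one factor [|P x|] cancels. *)
Lemma rnorm_le_trace (e : nat -> H) P (t : R) : orthonormal_basis e ->
  linear P -> nonneg_op P -> (trace_on e P <= t%:E)%E ->
  forall x, rnorm (P x) <= t * rnorm x.
Proof.
move=> eB Pl P0 Pt x.
have reP y : 0 <= complex.Re ⟪y, P y⟫ by have := P0 y; rewrite lecE => /andP[].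
have sum_le n : \sum_(0 <= j < n) complex.Re ⟪e j, P (e j)⟫ <= t.
  rewrite -lee_fin -sumEFin; apply: le_trans Pt; apply: nneseries_lim_ge => j _.
  by rewrite lee_fin.
have t0 : 0 <= t by have := sum_le 0%N; rewrite big_nil.
have CS n : series (fun j => rnorm ⟪e j, P x⟫ ^+ 2) n <= t * complex.Re ⟪x, P x⟫.
  apply: (@le_trans _ _
    ((\sum_(0 <= j < n) complex.Re ⟪e j, P (e j)⟫) * complex.Re ⟪x, P x⟫)).
    rewrite /series /= mulr_suml; apply: ler_sum => j _.
    apply: (@nonneg_form_CS R H (fun u v => ⟪u, P v⟫)) => [u a v w|u a v w|//].
      by rewrite Pl dotpZDr.
    by rewrite dotpZDl.
  by rewrite ler_wpM2r.
have := parseval_le eB CS.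
have : complex.Re ⟪x, P x⟫ <= rnorm x * rnorm (P x).
  apply: le_trans (CauchySchwarz _ _); apply: le_trans (ler_rnorm_Re _); exact: ler_norm.
have [-> _ _|Px0 h1 h2] := eqVneq (rnorm (P x)) 0.
  by rewrite mulr_ge0 ?rnorm_ge0.
have Px_gt0 : 0 < rnorm (P x) by rewrite lt_neqAle eq_sym Px0 rnorm_ge0.
rewrite -(ler_pM2r Px_gt0) -expr2 -mulrA; apply: le_trans h2 _.
by rewrite ler_wpM2l.
Qed.

(** An absolute value [P] of [T] satisfies [|P x| = |T x|], since [P \o P = adjoint T \o T]. The
    formal adjoint [T'] guarantees that [adjoint T] is a genuine adjoint and not the default value
    of [xget]. *)
Lemma rnorm_le_trace_norm T (T' : K -> H) (t : R) :
  (forall x y, ⟪y, T x⟫ = ⟪T' y, x⟫) -> (trace_norm T < t%:E)%E ->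
  forall x, rnorm (T x) <= t * rnorm x.
Proof.
move=> TT' /ereal_inf_lt[_ [e [P [eB [Pb P0 PT] ->]]] Pt] x.
apply: le_trans (rnorm_le_trace eB Pb.1 P0 (ltW Pt) x).
rewrite -(@ler_pXn2r _ 2) ?nnegrE ?rnorm_ge0// -!Re_dotpxx.
rewrite TT' -(adjointE TT') -[adjoint T _]/((adjoint T \o T) x) -PT /=.
by rewrite (nonneg_op_symmetric Pb.1 P0).
Qed.

End trace.

(** * Resolvents of a self-adjoint operator off the real axis *)

Section resolvent.
Context {R : realType}.
Context (H : hilbertType R) (A : partial_operator H).
Context (A_sa : self_adjoint A).
Implicit Types (u v x y : H) (z : R[i]).

Lemma self_adjoint_dotp u v : op_dom A u -> op_dom A v -> ⟪u, A v⟫ = ⟪A u, v⟫.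
Proof.
move=> Du Dv; have : adjoint_graph A (u, A u) by rewrite A_sa.2.
by move=> /(_ v Dv).
Qed.

Lemma self_adjoint_real u : op_dom A u -> complex.Im ⟪u, A u⟫ = 0.
Proof.
move=> Du; have := dotp_conj u (A u); rewrite -(self_adjoint_dotp Du Du).
case: ⟪u, A u⟫ => a b [] /= h; lra.
Qed.

(** [⟪u, A u⟫] is real, so [⟪u, (A - z) u⟫] has imaginary part [- Im z |u|^2]; Cauchy-Schwarz then
    bounds it. *)
Lemma shift_ge u z : op_dom A u ->
  `|complex.Im z| * rnorm u <= rnorm (A u - z *: u).
Proof.
move=> Du; have [u0|u0] := eqVneq (rnorm u) 0; first by rewrite u0 mulr0 rnorm_ge0.
have u_gt0 : 0 < rnorm u by rewrite lt_neqAle eq_sym u0 rnorm_ge0.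
rewrite -(ler_pM2r u_gt0) -mulrA -expr2 mulrC [leRHS]mulrC.
apply: le_trans (CauchySchwarz _ _); apply: le_trans (ler_rnorm_Im _).
rewrite dotpBr dotpZr ImB self_adjoint_real// sub0r normrN dotpxx.
case: z => a b; simpc => /=.
by rewrite normrM mulrC [`|rnorm u ^+ 2|]ger0_norm// sqr_ge0.
Qed.

(* [u] solves [(A - z) u = v] as soon as [⟪u, (A - conj z) x⟫ = ⟪v, x⟫] for
   every [x] in the domain, because self-adjointness says that the graph of
   [A] is its own adjoint graph. *)
Lemma self_adjoint_shift_surj z v : complex.Im z != 0 ->
  exists u, op_dom A u /\ A u - z *: u = v.
Proof.
move=> z0; have z_gt0 : 0 < `|complex.Im z| by rewrite normr_gt0.
have [u uP] : exists u, forall x, op_dom A x ->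
    ⟪u, (fun x => A x - z^*%C *: x) x⟫ = ⟪v, x⟫.
  (* The constant comes from Cauchy-Schwarz and [shift_ge] at the conjugate of [z]. *)
  apply: (@riesz_along R H H (op_dom A) (fun x => A x - z^*%C *: x) (fun x => ⟪v, x⟫)
    (rnorm v / `|complex.Im z|)).
  - exact: op_dom0.
  - exact: op_domP.
  - move=> a x y Dx Dy; rewrite op_linear// scalerDr scalerBr opprD addrACA.
    by rewrite !scalerA mulrC.
  - by move=> a x y _ _; rewrite dotpZDr.
  - move=> x Dx; apply: le_trans (CauchySchwarz _ _) _.
    rewrite -mulrA ler_wpM2l ?rnorm_ge0// mulrC ler_pdivlMr// mulrC.
    by have := @shift_ge x z^*%C Dx; case: (z) => a b /=; rewrite normrN.
exists u; have : adjoint_graph A (u, v + z *: u).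
  move=> x Dx /=; have := uP x Dx; rewrite /= dotpBr dotpZr dotpDl dotpZl => <-.
  by rewrite subrK.
by rewrite A_sa.2 => -[/= Du ->]; rewrite addrK.
Qed.

Lemma resolventP z v : complex.Im z != 0 ->
  op_dom A (resolvent A z v) /\ A (resolvent A z v) - z *: resolvent A z v = v.
Proof.
move=> z0; have [u uP] := self_adjoint_shift_surj v z0.
by rewrite /resolvent; case: xgetP => [w -> //|/(_ u)].
Qed.

(** Write [x] as [A - z] and [y] as [A - conj z] applied to their resolvents, then move [A] across
    the inner product. *)
Lemma resolvent_adjoint z x y : complex.Im z != 0 ->
  ⟪y, resolvent A z x⟫ = ⟪resolvent A z^*%C y, x⟫.
Proof.
move=> z0; have z0' : complex.Im z^*%C != 0 by case: (z) z0 => a b /=; rewrite oppr_eq0.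
have [Du {2}<-] := resolventP x z0; have [Dw {1}<-] := resolventP y z0'.
rewrite dotpBl dotpBr dotpZl dotpZr self_adjoint_dotp//=.
by rewrite conjcK.
Qed.

Lemma im_op_resolventE z x : complex.Im z != 0 ->
  im_op (resolvent A z) x = (2 * 'i%C)^-1 *: (resolvent A z x - resolvent A z^*%C x).
Proof.
move=> z0; rewrite /im_op (@adjointE _ _ _ _ (resolvent A z^*%C))// => u v.
exact: resolvent_adjoint.
Qed.

Lemma conjc_2iV : ((2 * 'i%C)^-1)^*%C = - (2 * 'i%C)^-1 :> R[i].
Proof.
rewrite conjc_inv -invrN; congr (_^-1).
by apply/eqP; rewrite eq_complex /=; simpc.
Qed.

Lemma im_op_resolvent_symmetric z x y : complex.Im z != 0 ->
  ⟪y, im_op (resolvent A z) x⟫ = ⟪im_op (resolvent A z) y, x⟫.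
Proof.
move=> z0; have z0' : complex.Im z^*%C != 0 by case: (z) z0 => a b /=; rewrite oppr_eq0.
rewrite !im_op_resolventE// dotpZr dotpZl dotpBr dotpBl conjc_2iV.
by rewrite !resolvent_adjoint// conjcK mulNr -mulrN opprB.
Qed.

(** With [u = R_z x] and [x = (A - z) u], the value [⟪x, Im R_z x⟫ = Im ⟪x, u⟫] equals
    [Im z |u|^2]. *)
Lemma im_op_resolvent_ge0 z : 0 < complex.Im z -> nonneg_op (im_op (resolvent A z)).
Proof.
move=> z_gt0 x; have z0 : complex.Im z != 0 by rewrite gt_eqF.
rewrite im_op_resolventE// dotpZr dotpBr.
rewrite [X in _ - X]dotp_conj -resolvent_adjoint//.
have : complex.Im ⟪x, resolvent A z x⟫ = complex.Im z * rnorm (resolvent A z x) ^+ 2.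
  have [Du {1}<-] := resolventP x z0.
  rewrite dotpBl dotpZl ImB -self_adjoint_dotp// self_adjoint_real// dotpxx.
  by case: (z) => a b; simpc => /=; ring.
case: ⟪x, _⟫ => a b /= ->; set c := _ * _ ^+ 2.
rewrite (_ : _ - _ = 2 * 'i%C * c%:C); last first.
  by apply/eqP; rewrite eq_complex /=; simpc; apply/eqP => /=; ring.
rewrite mulKf; first by rewrite ler0c mulr_ge0 ?sqr_ge0// ltW.
by apply: mulf_neq0; rewrite ?pnatr_eq0 // eq_complex /= oner_eq0 andbF.
Qed.

End resolvent.

(** * The frame operator and the limit of the sandwiched resolvent *)

Section frame.
Context {R : realType}.
Context (H K : hilbertType R) (F : H -> K) (kappa : nat -> R).
Context (phi : nat -> H) (psi : nat -> K).
Context (FF : frame_operator F kappa phi psi).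

Lemma frame_coord i x : ⟪psi i, F x⟫ = (kappa i)%:C * ⟪phi i, x⟫.
Proof.
exact: (@orthonormal_coord R K psi (fun j => (kappa j)%:C * ⟪phi j, x⟫) _ i
  (frame_basis_codom FF).1 (@frameE _ _ _ _ _ _ _ FF x)).
Qed.

(** Linearity is read off the coordinates in [psi]. The bound is [kappa 0], the largest weight,
    through Parseval in [K] and Bessel in [H]. *)
Lemma frame_bounded : bounded_operator F.
Proof.
have k0 : 0 <= kappa 0 by exact: ltW (frame_gt0 FF 0).
apply: (@bounded_operatorI _ _ _ _ (kappa 0)) => [a x y|x].
  apply: (basis_inj (frame_basis_codom FF)) => i.
  by rewrite dotpZDr !frame_coord dotpZDr; ring.
rewrite -(@ler_pXn2r _ 2) ?nnegrE ?mulr_ge0 ?rnorm_ge0// exprMn.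
apply: (parseval_le (frame_basis_codom FF)) => n.
apply: (@le_trans _ _ (kappa 0 ^+ 2 * series (fun j => rnorm ⟪phi j, x⟫ ^+ 2) n)).
  rewrite /series /= mulr_sumr; apply: ler_sum => j _.
  rewrite frame_coord rnormM exprMn ler_wpM2r ?sqr_ge0//.
  have kj := ltW (frame_gt0 FF j).
  by rewrite rnorm_real_ge0// ler_pXn2r ?nnegrE// (frame_decreasing FF).
by rewrite ler_wpM2l ?sqr_ge0//; exact: bessel (frame_basis_dom FF) x n.
Qed.

Lemma frame_adjoint_basis j : adjoint F (psi j) = (kappa j)%:C *: phi j.
Proof.
by apply: adjoint_eq => x; rewrite frame_coord dotpZl conjc_real.
Qed.

Context (H0 : partial_operator H) (l : R).
Context (H0_sa : self_adjoint H0).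

Let S (y : R) := im_op (resolvent H0 (l +i* y)).
Let T (y : R) := F \o S y \o adjoint F.

Lemma dotp_sandwiched_im_resolvent y u v : ⟪u, T y v⟫ = ⟪adjoint F u, S y (adjoint F v)⟫.
Proof. by rewrite /T /= (bounded_adjointP frame_bounded). Qed.

Lemma sandwiched_im_resolvent_coef y i j : 0 < y ->
  ⟪psi i, T y (psi j)⟫ = (kappa i * kappa j)%:C * im_resolvent_coef H0 phi l i j y.
Proof.
move=> y0; have z0 : complex.Im (l +i* y) != 0 by rewrite /= gt_eqF.
rewrite dotp_sandwiched_im_resolvent !frame_adjoint_basis dotpZl conjc_real.
(* The scalar [kappa j] is freed by moving [Im R] to the left argument; the next line moves it
   back. *)
rewrite (im_op_resolvent_symmetric H0_sa _ _ z0) dotpZr.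
by rewrite -(im_op_resolvent_symmetric H0_sa _ _ z0) mulrA -rmorphM.
Qed.

(** Turns trace-norm convergence into a uniform estimate on vectors. [0 < y] is recorded because the
    resolvent facts hold off the real axis. *)
Lemma trace_norm_limit_near (B : K -> K) : bounded_operator B ->
  trace_norm (fun v => T y v - B v) @[y --> 0^'+] --> 0%E ->
  forall e : R, 0 < e ->
  \forall y \near 0^'+, 0 < y /\ forall x, rnorm (T y x - B x) <= e * rnorm x.
Proof.
move=> bB cB e e0.
have lt_e : \forall y \near 0^'+, (trace_norm (fun v => T y v - B v)%R < e%:E)%E.
  apply: (cB [set t | (t < e%:E)%E]); apply: open_nbhs_nbhs; split.
    exact: open_ereal_lt_ereal.
  by rewrite /= lte_fin.
near=> y.
have y0 : 0 < y by near: y; exact: nbhs_right_gt.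
(* [T y] is symmetric, so the formal adjoint of [T y - B] is [T y - adjoint B]. *)
split=> // x; apply: (@rnorm_le_trace_norm R K K
  (fun v => T y v - B v) (fun v => T y v - adjoint B v)).
  move=> u v /=; have z0 : complex.Im (l +i* y) != 0 by rewrite /= gt_eqF.
  rewrite dotpBr dotpBl (bounded_adjointP bB) dotp_sandwiched_im_resolvent.
  rewrite (im_op_resolvent_symmetric H0_sa _ _ z0).
  by rewrite /T /= dotp_conj -(bounded_adjointP frame_bounded) -dotp_conj.
by near: y.
Unshelve. all: by end_near. Qed.

Lemma im_resolvent_coef_limit : Lambda H0 F l ->
  exists B : K -> K, [/\ trace_class B, nonneg_op B &
    forall i j, im_resolvent_coef H0 phi l i j y @[y --> 0^'+] -->
      ((kappa i * kappa j)^-1%:C * ⟪psi i, B (psi j)⟫ : R[i]^o)].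
Proof.
move=> [_ [B tB cB]]; have nearB := trace_norm_limit_near tB.1 cB.
exists B; split=> // [x|i j].
  (* [⟪x, B x⟫] is approximated by non-negative reals [⟪x, T y x⟫]. The error is at most
     [e |x|^2 / (|x|^2 + 1)], where the [+ 1] covers [x = 0]. *)
  have approx e : 0 < e -> exists2 t : R, 0 <= t & rnorm (t%:C - ⟪x, B x⟫) <= e.
    move=> e0; have e1 : 0 < e / (rnorm x ^+ 2 + 1).
      by rewrite divr_gt0// ltr_wpDl// sqr_ge0.
    have [y [y0 yP]] := filter_ex (nearB _ e1).
    exists (complex.Re ⟪x, T y x⟫).
      have : 0 <= ⟪x, T y x⟫ by rewrite dotp_sandwiched_im_resolvent im_op_resolvent_ge0.
      by rewrite lecE => /andP[].
    rewrite RRe_real; last first.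
      by rewrite ger0_real// dotp_sandwiched_im_resolvent; exact: im_op_resolvent_ge0.
    rewrite -dotpBr; apply: le_trans (CauchySchwarz _ _) _.
    apply: (@le_trans _ _ (rnorm x * (e / (rnorm x ^+ 2 + 1) * rnorm x))).
      by rewrite ler_wpM2l ?rnorm_ge0.
    rewrite [leLHS](_ : _ = e * (rnorm x ^+ 2 / (rnorm x ^+ 2 + 1))); last first.
      by field; rewrite gt_eqF// ltr_wpDl// sqr_ge0.
    rewrite ger_pMr// ler_pdivrMr ?mul1r ?lerDl//.
    by rewrite ltr_wpDl// sqr_ge0.
  rewrite lecE; apply/andP; split.
    rewrite -normr_le0; apply/ler_addgt0Pl => e /approx[t _ tP].
    have := le_trans (ler_rnorm_Im _) tP; rewrite ImB /= sub0r normrN; lra.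
  apply/ler_addgt0Pl => e /approx[t t0 tP].
  have := le_trans (ler_rnorm_Re _) tP; rewrite ReB /= ler_norml; lra.
apply/cvg_rnormP => e e0.
have k0 : 0 < kappa i * kappa j by rewrite mulr_gt0// (frame_gt0 FF).
(* Dividing the entry by [kappa i * kappa j] leaves an error of at most [e / 2], hence strictly
   below [e]. *)
have e1 : 0 < e / 2 * (kappa i * kappa j) by rewrite mulr_gt0// divr_gt0.
apply: filterS (nearB _ e1) => y [y0 yP].
have -> : im_resolvent_coef H0 phi l i j y = (kappa i * kappa j)^-1%:C * ⟪psi i, T y (psi j)⟫.
  by rewrite sandwiched_im_resolvent_coef// mulrA -rmorphM /= mulVf ?gt_eqF// mul1r.
rewrite -mulrBr rnormM rnorm_real_ge0 ?invr_ge0 ?ltW// -dotpBr.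
have psi1 k : rnorm (psi k) = 1.
  apply/eqP; rewrite -sqrp_eq1 ?rnorm_ge0// -Re_dotpxx.
  by rewrite (frame_basis_codom FF).1 eqxx.
apply: (@le_lt_trans _ _ (e / 2)); last lra.
rewrite mulrC ler_pdivrMr//; apply: le_trans (CauchySchwarz _ _) _.
by rewrite psi1 mul1r rnormB (le_trans (yP _))// psi1 mulr1.
Qed.

End frame.

(** * The unitary coordinate map onto square-summable sequences *)

Section coordinates.
Context {R : realType}.
Context (K : hilbertType R) (psi : nat -> K).
Context (psiB : orthonormal_basis psi).
Implicit Types (x y : K) (a b : ell2 R) (e : nat -> K).

Lemma coords_square_summable x : (fun j => ⟪psi j, x⟫) \in @square_summable R.
Proof.
by apply/square_summableP/cvg_ex; eexists; exact: parseval.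
Qed.

Definition coords x : ell2 R := Ell2 (coords_square_summable x).

Lemma coordsE x j : coords x j = ⟪psi j, x⟫. Proof. by []. Qed.

Lemma dotp_coords x y : ⟪coords x, coords y⟫ = ⟪x, y⟫.
Proof. exact: (cvg_lim (@norm_hausdorff _ _) (@parseval_dotp R K psi psiB x y)). Qed.

Lemma rnorm_coords x : rnorm (coords x) = rnorm x.
Proof.
by apply/eqP; rewrite -(@eqrXn2 _ 2) ?rnorm_ge0// -!Re_dotpxx dotp_coords.
Qed.

Lemma coords_linear : linear coords.
Proof. by move=> k x y; apply/val_inj/funext => j; rewrite /= dotpZDr. Qed.

Lemma coords_inj : injective coords.
Proof.
by move=> x y xy; apply: (basis_inj psiB) => i; rewrite -!coordsE xy.
Qed.

Lemma dotp_coords_basis a n : ⟪a, coords (psi n)⟫ = (a n)^*%C.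
Proof.
apply: (@cvg_lim R[i]^o); first exact: norm_hausdorff.
apply: cvg_near_cst; exists n.+1 => // m /= nm.
rewrite /series /= big_mkord (bigD1 (Ordinal nm))//= psiB.1 eqxx mulr1.
rewrite big1 ?addr0// => j jn; rewrite psiB.1 (_ : (_ == n) = false) ?mulr0//.
by apply/negbTE; apply: contra jn => /eqP jn; apply/eqP/val_inj.
Qed.

(** The preimage is the Riesz vector of [x ↦ ⟪a, coords x⟫]; testing it on [psi n] recovers
    [a n]. *)
Lemma coords_surj a : exists x, coords x = a.
Proof.
have [u uP] : exists u, forall x, ⟪u, x⟫ = ⟪a, coords x⟫.
  apply: (@riesz R K (fun x => ⟪a, coords x⟫) (rnorm a)) => [k x y|x].
    by rewrite coords_linear dotpZDr.
  by rewrite -(rnorm_coords x); exact: CauchySchwarz.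
exists u; apply/val_inj/funext => n /=.
by rewrite dotp_conj uP dotp_coords_basis conjcK.
Qed.

Definition synth a : K := xget 0 [set x | coords x = a].

Lemma synthK : cancel synth coords.
Proof.
by move=> a; rewrite /synth; case: xgetP => // h; have [x xa] := coords_surj a; have := h x.
Qed.

Lemma coordsK : cancel coords synth.
Proof. by move=> x; apply: coords_inj; rewrite synthK. Qed.

Lemma synth_linear : linear synth.
Proof. by move=> k a b; apply: coords_inj; rewrite coords_linear !synthK. Qed.

Lemma dotp_synth a x : ⟪a, coords x⟫ = ⟪synth a, x⟫.
Proof. by rewrite -dotp_coords synthK. Qed.

Lemma rnorm_synth a : rnorm (synth a) = rnorm a.
Proof. by rewrite -rnorm_coords synthK. Qed.

(** Transport along the unitary [coords], with a factor that will be [pi^-1]. *)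
Definition to_ell2 (c : R) (T : K -> K) a : ell2 R := c%:C *: coords (T (synth a)).

Context (c : R).
Context (c0 : 0 <= c).
Implicit Types T P : K -> K.

Lemma dotp_to_ell2 T a b : ⟪a, to_ell2 c T b⟫ = c%:C * ⟪synth a, T (synth b)⟫.
Proof. by rewrite /to_ell2 dotpZr dotp_synth. Qed.

Lemma to_ell2_bounded T : bounded_operator T -> bounded_operator (to_ell2 c T).
Proof.
move=> bT; have [M M0 TM] := bounded_operator_le bT.
apply: (@bounded_operatorI _ _ _ _ (c * M)) => [k a b|a].
  by rewrite /to_ell2 synth_linear bT.1 coords_linear scalerDr !scalerA mulrC.
rewrite /to_ell2 rnormZ rnorm_real_ge0// rnorm_coords -mulrA ler_wpM2l//.
by rewrite -(rnorm_synth a).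
Qed.

Lemma to_ell2_nonneg T : nonneg_op T -> nonneg_op (to_ell2 c T).
Proof. by move=> T0 a; rewrite dotp_to_ell2 mulr_ge0// ler0c. Qed.

Lemma adjoint_to_ell2 T : bounded_operator T ->
  adjoint (to_ell2 c T) = to_ell2 c (adjoint T).
Proof.
move=> bT; apply: adjointE => a b.
rewrite dotp_to_ell2 (bounded_adjointP bT) [RHS]dotp_conj dotp_to_ell2.
by rewrite rmorphM /= oppr0 -dotp_conj.
Qed.

(** Unitary transport respects adjoints and composition, and both sides of [P \o P = adjoint T \o T]
    acquire the factor [c ^+ 2]. *)
Lemma to_ell2_abs T P : bounded_operator T -> is_abs_op T P ->
  is_abs_op (to_ell2 c T) (to_ell2 c P).
Proof.
move=> bT [bP P0 PT]; split; [exact: to_ell2_bounded|exact: to_ell2_nonneg|].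
rewrite adjoint_to_ell2//; apply/funext => a /=; rewrite /to_ell2.
have adjZ k y : adjoint T (k *: y) = k *: adjoint T y.
  by apply: dotp_inj => x; rewrite -(bounded_adjointP bT) !dotpZl (bounded_adjointP bT).
rewrite !(linear_opZ synth_linear) !coordsK (linear_opZ bP.1) adjZ.
by rewrite -[P (P _)]/((P \o P) _) PT.
Qed.

Lemma coords_basis e : orthonormal_basis e -> orthonormal_basis (coords \o e).
Proof.
move=> [eo eB]; split=> [i j|a]; first by rewrite /= dotp_coords.
apply/cvg_rnormP => r r0.
have /cvg_rnormP/(_ r r0) := eB (synth a); apply: filterS => n.
rewrite -rnorm_coords; congr (rnorm _ < _).
(* The remainder is put in the form [-1 *: u + v] so that linearity of [coords] applies. *)
rewrite -scaleN1r addrC coords_linear synthK scaleN1r addrC; congr (_ - _).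
elim: n => [|n IHn]; first by rewrite !big_ord0 (linear_op0 coords_linear).
rewrite !big_ord_recr /= addrC coords_linear IHn addrC; congr (_ + _ *: _).
by rewrite -[a in RHS]synthK dotp_coords.
Qed.

Lemma trace_on_to_ell2 e P : nonneg_op P ->
  trace_on (coords \o e) (to_ell2 c P) = (c%:E * trace_on e P)%E.
Proof.
move=> P0; rewrite /trace_on -nneseriesZl => [|j _].
  apply: eq_eseriesr => j _.
  by rewrite -EFinM /= dotp_to_ell2 !coordsK; congr (_%:E); case: ⟪_, _⟫ => u v; simpc.
by have := P0 (e j); rewrite lecE lee_fin => /andP[].
Qed.

(** An infimum below infinity supplies a basis and an absolute value of finite trace; their
    transports witness a finite trace norm on the other side. *)
Lemma to_ell2_trace_class T : trace_class T -> trace_class (to_ell2 c T).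
Proof.
move=> [bT /ereal_inf_lt[_ [e [P [eB TP ->]]] Pt]].
split; first exact: to_ell2_bounded.
apply: (@le_lt_trans _ _ (trace_on (coords \o e) (to_ell2 c P))).
  apply: ereal_inf_lbound; exists (coords \o e), (to_ell2 c P); split=> //.
    exact: coords_basis.
  exact: to_ell2_abs.
have [_ P0 _] := TP; rewrite trace_on_to_ell2//.
have t0 : (0 <= trace_on e P)%E.
  apply: nneseries_ge0 => j _ _.
  by have := P0 (e j); rewrite lecE lee_fin => /andP[].
have /fineK <- : trace_on e P \is a fin_num by rewrite ge0_fin_numE.
by rewrite -EFinM ltry.
Qed.

(** The [i]-th coordinate of the image is an inner product against [c%:C *: adjoint T (psi i)];
    Parseval expands it into the matrix row. *)
Lemma to_ell2_matrix T : bounded_operator T ->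
  operator_of_matrix (fun i j => c%:C * ⟪psi i, T (psi j)⟫) (to_ell2 c T).
Proof.
move=> bT a i.
have -> : to_ell2 c T a i = ⟪c%:C *: adjoint T (psi i), synth a⟫.
  by rewrite dotpZl conjc_real -(bounded_adjointP bT).
rewrite (_ : series _ = series (fun j => ⟪psi j, c%:C *: adjoint T (psi i)⟫^*%C *
    ⟪psi j, synth a⟫ : R[i]^o)); first exact: parseval_dotp.
congr (series _); apply/funext => j.
by rewrite -dotp_conj dotpZl conjc_real -(bounded_adjointP bT) -(coordsE (synth a)) synthK.
Qed.

End coordinates.

End trace_class_limit.

Theorem proposition3p4 (R : realType) (H K : hilbertType R)
  (sepH : separable_space H) (sepK : separable_space K)
  (H0 : partial_operator H) (H0_sa : self_adjoint H0)
  (F : H -> K) (kappa : nat -> R) (phi : nat -> H) (psi : nat -> K)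
  (F_frame : frame_operator F kappa phi psi)
  (lambda : R) (lambdaP : Lambda H0 F lambda) :
  (forall i j : nat, cvg (im_resolvent_coef H0 phi lambda i j y @[y --> 0^'+])) /\
  (exists Phi : ell2 R -> ell2 R,
    [/\ operator_of_matrix (phi_matrix H0 kappa phi lambda) Phi,
        nonneg_op Phi & trace_class Phi]).
Proof.
have [B [tB B0 cB]] := im_resolvent_coef_limit F_frame H0_sa lambdaP.
split=> [i j|]; first by apply/cvg_ex; eexists; exact: cB.
have psiB := frame_basis_codom F_frame.
have pi0 : 0 <= (pi : R)^-1 by rewrite invr_ge0 pi_ge0.
exists (to_ell2 psiB pi^-1 B); split.
- rewrite (_ : phi_matrix _ _ _ _ =
    (fun i j => (real_complex R pi^-1 * dotp (psi i) (B (psi j)))%R)).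
    by apply: to_ell2_matrix; exact: tB.1.
  apply/funext => i; apply/funext => j; rewrite /phi_matrix.
  (* The weights [kappa i * kappa j] cancel the inverse weights in the limit, which leaves
     [pi^-1]. *)
  rewrite (cvg_lim (@norm_hausdorff _ _) (cB i j)) mulrA -rmorphM /= -mulrA.
  rewrite -mulrA mulfV ?mulr1// mulf_neq0 ?gt_eqF//; exact: (frame_gt0 F_frame).
- exact: to_ell2_nonneg.
- exact: to_ell2_trace_class.
Qed.
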